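(* Let $f_0$, $f$ and $\mathcal D$ be as in the context. If the Old Qualifying Conditions hold (that is, for all $x\in\mathcal D$, condition (0) holds together with at least one of the cases (i), (ii), (iii)), then the General Qualifying Condition holds for all $x\in\mathcal D$.
   Context: Data: $f_0:\mathbb R^n\to\mathbb R^m$ ($m\ge1$) and $f:\mathbb R^n\to\mathbb R^n$ are differentiable; $\mathcal D=\{x\in\mathbb R^n:a\le x\le b\}$ is a box with $f(\mathcal D)\subseteq\mathcal D$. Notation: all inequalities between vectors or matrices are element-wise. $[\nabla f(x)]_{ij}=\partial f_j(x)/\partial x_i$ (transposed Jacobian), similarly $\nabla f_0(x)\in\mathbb R^{n\times m}$; $\nabla_i f_0(x)$ is the $i$-th row of $\nabla f_0(x)$. $\nabla f(x)^k$ is the $k$-th matrix power. $\|A\|_\infty=\max_i\sum_j|A_{ij}|$; $\mathbf 1$ is the all-ones vector. Old Qualifying Conditions: for all $x\in\mathcal D$, condition (0) and at least one of the cases (i), (ii), (iii) hold, where (0) $\nabla f_0(x)>0$; Case (i): $\nabla f(x)\ge0$ and $\|\nabla f(x)\|<1$ for some matrix norm (the same for all $x\in\mathcal D$); Case (ii): $f_0(x)=c\,\mathbf 1^Tx$ with $c>0$; $\nabla f(x)\le0$ (or more generally $\nabla f(x)^2\ge0$); and $\|\nabla f(x)\|_\infty<1$; Case (iii): $f_0$ is scalar valued ($m=1$) and $\|\nabla f(x)\|_\infty<\dfrac{\bar\delta}{\bar\delta+\bar\Delta}$, where $\bar\delta=\min_i\min_{x\in\mathcal D}\nabla_if_0(x)$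 and $\bar\Delta=\max_i\max_{x\in\mathcal D}\nabla_if_0(x)$. General Qualifying Condition (at $x$): let $q(x)=\min_j \frac{\min_i[\nabla f_0(x)]_{ij}}{\max_i[\nabla f_0(x)]_{ij}}$. (a) $\nabla f_0(x)\ge 0$ and every row of $\nabla f_0(x)$ is non-zero; (b) $\|\nabla f(x)\|<1$, where $\|\cdot\|$ is some (sub-multiplicative) matrix norm, the same for all $x\in\mathcal D$; and there exists $k\in\{1,2,\dots\}\cup\{\infty\}$ such that (c) if $k<\infty$, then $\nabla f(x)^k\ge0$; (d) if $k>1$, then $\left\|\sum_{l=1}^{k-1}\nabla f(x)^l\right\|_\infty<q(x)$. The same one of the cases (i)–(iii) is meant to hold for all $x\in\mathcal D$. *)

(* Defs.v *)
From mathcomp Require Import all_boot all_order all_algebra.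
From mathcomp Require Import all_classical all_reals all_analysis.
Import Order.TTheory GRing.Theory Num.Theory.
Import numFieldNormedType.Exports.

Set Implicit Arguments.
Unset Strict Implicit.
Unset Printing Implicit Defensive.

Local Open Scope classical_set_scope.
Local Open Scope ring_scope.

(* Points of R^n are row vectors, so that the library's Jacobian ['J f x]
   satisfies ['J f x] i j = d f_j / d x_i: it is already the transposed
   Jacobian matrix "nabla f (x)".  Since minima and maxima over coordinates
   are taken, dimensions are positive and written n.+1 and m.+1. *)

Definition mx_le (R : realType) (p q : nat) (A B : 'M[R]_(p, q)) : Prop :=
  forall i j, A i j <= B i j.

Definition mx_lt (R : realType) (p q : nat) (A B : 'M[R]_(p, q)) : Prop :=
  forall i j, A i j < B i j.

Definition box (R : realType) (n : nat) (a b : 'rV[R]_n) : set 'rV[R]_n :=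
  [set x | mx_le a x /\ mx_le x b].

Definition min_ord (R : realType) (n : nat) (g : 'I_n.+1 -> R) : R :=
  \big[Num.min/g ord0]_i g i.

Definition max_ord (R : realType) (n : nat) (g : 'I_n.+1 -> R) : R :=
  \big[Num.max/g ord0]_i g i.

Definition norm_infty (R : realType) (n : nat) (A : 'M[R]_n.+1) : R :=
  max_ord (fun i => \sum_j `|A i j|).

Record matrix_norm (R : realType) (n : nat) (N : 'M[R]_n -> R) : Prop := {
  matrix_norm_ge0 : forall A, 0 <= N A;
  matrix_norm_eq0 : forall A, N A = 0 -> A = 0;
  matrix_normZ : forall (c : R) A, N (c *: A) = `|c| * N A;
  matrix_normD : forall A B, N (A + B) <= N A + N B;
  matrix_normM : forall A B, N (A *m B) <= N A * N B
}.

Section QualifyingConditions.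
Variables (R : realType) (n m : nat).
Variables (f0 : 'rV[R]_n.+1 -> 'rV[R]_m.+1) (f : 'rV[R]_n.+1 -> 'rV[R]_n.+1).
Variable D : set 'rV[R]_n.+1.

Definition case_i : Prop :=
  exists2 N : 'M[R]_n.+1 -> R, matrix_norm N &
    forall x, D x -> mx_le 0 ('J f x) /\ N ('J f x) < 1.

(* The formula for f_0 defines it on the whole space; it forces m = 1. *)
Definition case_ii : Prop :=
  [/\ m.+1 = 1%N,
      exists2 c : R, 0 < c & forall x j, f0 x 0 j = c * \sum_i x 0 i &
      forall x, D x ->
        (mx_le ('J f x) 0 \/ mx_le 0 ('J f x ^+ 2)) /\
        norm_infty ('J f x) < 1].

Definition grad_range (i : 'I_n.+1) : set R := [set 'J f0 x i ord0 | x in D].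

(* f_0 is only assumed differentiable, so the extrema over D are an infimum and
   a supremum; they are the minimum and the maximum when these exist. *)
Definition delta_bar : R := min_ord (fun i => inf (grad_range i)).

Definition Delta_bar : R := max_ord (fun i => sup (grad_range i)).

(* Boundedness is required because [sup] and [inf] have a default value on
   unbounded sets. *)
Definition case_iii : Prop :=
  [/\ m.+1 = 1%N,
      forall i, has_lbound (grad_range i) /\ has_ubound (grad_range i) &
      forall x, D x ->
        norm_infty ('J f x) < delta_bar / (delta_bar + Delta_bar)].

Definition old_qualifying : Prop :=
  (forall x, D x -> mx_lt 0 ('J f0 x)) /\ [\/ case_i, case_ii | case_iii].

Definition qratio (x : 'rV[R]_n.+1) : R :=
  min_ord (fun j => min_ord ('J f0 x ^~ j) / max_ord ('J f0 x ^~ j)).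

(* Conditions (c) and (d) for a given k; [None] stands for k = oo, in which
   case the sum in (d) is the limit of its partial sums. *)
Definition power_condition (x : 'rV[R]_n.+1) (k : option nat) : Prop :=
  match k with
  | Some k => [/\ (1 <= k)%N,
                  mx_le 0 ('J f x ^+ k) &
                  (1 < k)%N ->
                    norm_infty (\sum_(1 <= l < k) 'J f x ^+ l) < qratio x]
  | None => exists2 S : 'M[R]_n.+1,
              (fun k : nat => \sum_(1 <= l < k) 'J f x ^+ l) @ \oo --> S &
              norm_infty S < qratio x
  end.

Definition general_qualifying (N : 'M[R]_n.+1 -> R) (x : 'rV[R]_n.+1) : Prop :=
  [/\ mx_le 0 ('J f0 x) /\ (forall i, row i ('J f0 x) != 0),
      N ('J f x) < 1 &
      exists k : option nat, power_condition x k].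

End QualifyingConditions.

(* Main.v *)
Require Import Defs.
From mathcomp Require Import all_boot all_order all_algebra.
From mathcomp Require Import all_classical all_reals all_analysis.
Import Order.TTheory GRing.Theory Num.Theory.
Import numFieldNormedType.Exports.
Local Open Scope classical_set_scope.
Local Open Scope ring_scope.

(** Write [J] for the transposed Jacobian of [f] at [x].  Each old case yields
    one value of the exponent [k] in the general condition, and a norm.

    In case (i), [k = 1] works with the given norm: [J] itself is nonnegative
    and the sum condition is void.

    In case (ii), [k = 2] works with the infinity norm.  A nonpositive matrix
    has a nonnegative square, and the sum condition reads [|J| < q(x)].  Since
    [f0] is [c] times the coordinate sum, all entries of its gradient equal
    [c], so that [q(x) = 1].

    In case (iii), [k = oo] works with the infinity norm.  Put [r = |J|].  The
    Neumann series [J + J^2 + ...] converges because it is dominated by a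
    geometric series, and its sum has norm at most [r / (1 - r)]
    ([neumann_series]).  The hypothesis [r < delta / (delta + Delta)] gives
    [r / (1 - r) < delta / Delta] ([ratio_lt_of_lt_share]), and
    [delta / Delta <= q(x)] because [delta] and [Delta] bound all gradient
    entries over the whole box ([qratio_ge_extrema]).

    Positivity of the gradient of [f0] gives condition (a) in all cases. *)

(** * Extrema over a finite index set *)

Lemma le_min_ord {R : realType} {n : nat} (g : 'I_n.+1 -> R) (r : R) :
  (forall i, r <= g i) -> r <= min_ord g.
Proof. by move=> rg; exact: le_bigmin. Qed.

Lemma max_ord_le {R : realType} {n : nat} (g : 'I_n.+1 -> R) (r : R) :
  (forall i, g i <= r) -> max_ord g <= r.
Proof. by move=> gr; exact: bigmax_le. Qed.

Lemma min_ord_lower {R : realType} {n : nat} (g : 'I_n.+1 -> R) i :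
  min_ord g <= g i.
Proof. exact: bigmin_le. Qed.

Lemma max_ord_upper {R : realType} {n : nat} (g : 'I_n.+1 -> R) i :
  g i <= max_ord g.
Proof. exact: le_bigmax. Qed.

Lemma max_ord_gt0 {R : realType} {n : nat} (g : 'I_n.+1 -> R) :
  (forall i, 0 < g i) -> 0 < max_ord g.
Proof. by move=> g0; exact: lt_le_trans (g0 ord0) (max_ord_upper _ _). Qed.

(** * The infinity norm is a submultiplicative matrix norm *)

Lemma row_le_norm_infty {R : realType} {n : nat} (A : 'M[R]_n.+1) i :
  \sum_j `|A i j| <= norm_infty A.
Proof. exact: (max_ord_upper (fun i => \sum_j `|A i j|)). Qed.

Lemma entry_le_norm_infty {R : realType} {n : nat} (A : 'M[R]_n.+1) i j :
  `|A i j| <= norm_infty A.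
Proof.
apply: le_trans (row_le_norm_infty A i).
by rewrite (bigD1 j) //= lerDl sumr_ge0.
Qed.

Lemma norm_infty_ge0 {R : realType} {n : nat} (A : 'M[R]_n.+1) :
  0 <= norm_infty A.
Proof. by apply: le_trans (entry_le_norm_infty A ord0 ord0). Qed.

Lemma norm_infty_matrix_norm (R : realType) (n : nat) :
  matrix_norm (@norm_infty R n).
Proof.
split.
- exact: norm_infty_ge0.
- move=> A A0; apply/matrixP => i j; rewrite mxE; apply/eqP.
  by rewrite -normr_le0 -A0 entry_le_norm_infty.
- have scale_le (c : R) (A : 'M[R]_n.+1) :
      norm_infty (c *: A) <= `|c| * norm_infty A.
    apply: max_ord_le => i.
    under eq_bigr do rewrite mxE normrM.
    by rewrite -mulr_sumr ler_wpM2l ?row_le_norm_infty.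
  (* The converse inequality is [scale_le] for [c^-1] and [c *: A]. *)
  move=> c A; apply/eqP; rewrite eq_le scale_le /=.
  have [->|c0] := eqVneq c 0; first by rewrite normr0 mul0r norm_infty_ge0.
  rewrite -ler_pdivlMl ?normr_gt0// -normfV.
  by have := scale_le c^-1 (c *: A); rewrite scalerA mulVf// scale1r.
- move=> A B; apply: max_ord_le => i.
  apply: (le_trans _ (lerD (row_le_norm_infty A i) (row_le_norm_infty B i))).
  by rewrite -big_split /= ler_sum// => j _; rewrite mxE ler_normD.
- move=> A B; apply: max_ord_le => i.
  apply: (@le_trans _ _ (\sum_j \sum_k `|A i k| * `|B k j|)).
    apply: ler_sum => j _; rewrite mxE; apply: le_trans (ler_norm_sum _ _ _) _.
    by under eq_bigr do rewrite normrM.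
  (* Summing over [j] first turns the inner sums into row sums of [B]. *)
  rewrite exchange_big /=; under eq_bigr do rewrite -mulr_sumr.
  apply: (@le_trans _ _ (\sum_k `|A i k| * norm_infty B)).
    by apply: ler_sum => k _; rewrite ler_wpM2l ?row_le_norm_infty.
  by rewrite -mulr_suml ler_wpM2r ?row_le_norm_infty ?norm_infty_ge0.
Qed.

(** The exponent is positive because the norm of the identity matrix may
    exceed [1]. *)
Lemma matrix_norm_expS {R : realType} {n : nat} (N : 'M[R]_n.+1 -> R)
    (A : 'M[R]_n.+1) (k : nat) :
  matrix_norm N -> N (A ^+ k.+1) <= N A ^+ k.+1.
Proof.
move=> nN; elim: k => [|k IH]; first by rewrite !expr1.
rewrite exprS [leRHS]exprS; apply: le_trans (matrix_normM nN _ _) _.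
by rewrite ler_wpM2l ?(matrix_norm_ge0 nN).
Qed.

Lemma matrix_norm_sum {R : realType} {n : nat} (N : 'M[R]_n.+1 -> R)
    (I : Type) (s : seq I) (F : I -> 'M[R]_n.+1) :
  matrix_norm N -> N (\sum_(i <- s) F i) <= \sum_(i <- s) N (F i).
Proof.
move=> nN; elim/big_rec2: _ => [|i y A _ Ay].
  by rewrite -(scale0r (0 : 'M[R]_n.+1)) (matrix_normZ nN) normr0 mul0r.
by apply: le_trans (matrix_normD nN _ _) _; rewrite lerD2l.
Qed.

(** * The Neumann series without its constant term *)

Lemma geometric_sumS_le {R : realType} (r : R) (k : nat) : 0 <= r < 1 ->
  \sum_(0 <= l < k) r ^+ l.+1 <= r / (1 - r).
Proof.
move=> /andP[r0 r1].
have -> : \sum_(0 <= l < k) r ^+ l.+1 = series (geometric r r) k.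
  by apply: eq_bigr => l _; rewrite exprS.
rewrite geometric_seriesE ?lt_eqF// ler_wpM2r ?invr_ge0 ?subr_ge0 ?(ltW r1)//.
by rewrite ler_piMr// gerBl exprn_ge0.
Qed.

(** Neighbourhoods of a matrix are generated by products of neighbourhoods of
    its finitely many entries. *)
Lemma cvg_mx {R : realType} {p q : nat} {T : Type} {F : set_system T}
    {FF : Filter F} (u : T -> 'M[R]_(p, q)) (S : 'M[R]_(p, q)) :
  (forall i j, u x i j @[x --> F] --> S i j) -> u x @[x --> F] --> S.
Proof.
move=> uS A [P SP PA].
have FP : \forall x \near F, forall i j, P i j (u x i j).
  apply: filter_forall => i; apply: filter_forall => j.
  exact: uS (SP i j).
by apply: filterS FP => x Px; exact: PA.
Qed.

(** Each absolute row sum is a continuous function of the matrix, so a bound on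
    the row sums passes to the limit. *)
Lemma norm_infty_lim_le {R : realType} {n : nat} (u : nat -> 'M[R]_n.+1)
    (S : 'M[R]_n.+1) (M : R) :
  u k @[k --> \oo] --> S -> (forall k, norm_infty (u k) <= M) ->
  norm_infty S <= M.
Proof.
move=> uS uM; apply: max_ord_le => i.
have lim : \sum_j `|u k i j| @[k --> \oo] --> \sum_j `|S i j|.
  apply: cvg_big => [|j _]; first exact: add_continuous.
  apply: cvg_norm; exact: (continuous_cvg _ (@coord_continuous _ _ _ i j S) uS).
apply: (cvgr_to_le lim); near=> k.
exact: le_trans (row_le_norm_infty _ _) (uM k).
Unshelve. all: by end_near. Qed.

(** Put [r = norm_infty A].  Every entry of [A ^+ l] is at most [r ^+ l] in absolute
    value, so the series converges entrywise by comparison with a geometric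
    series.  The partial sums obey the stated bound by the triangle inequality,
    hence so does the limit. *)
Lemma neumann_series {R : realType} {n : nat} (A : 'M[R]_n.+1) :
  norm_infty A < 1 ->
  exists2 S : 'M[R]_n.+1,
    (fun k : nat => \sum_(1 <= l < k) A ^+ l) @ \oo --> S &
    norm_infty S <= norm_infty A / (1 - norm_infty A).
Proof.
set r := norm_infty A => r1.
have r0 : 0 <= r by exact: norm_infty_ge0.
have nN := norm_infty_matrix_norm R n.
have powA l : norm_infty (A ^+ l.+1) <= r ^+ l.+1.
  by exact: matrix_norm_expS.
pose u (k : nat) := \sum_(0 <= l < k) A ^+ l.+1.
have uE k : \sum_(1 <= l < k.+1) A ^+ l = u k by rewrite big_add1.
have entry_cvg i j : cvgn (series (fun l => (A ^+ l.+1) i j)).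
  apply: normed_cvg.
  apply: (@series_le_cvg _ _ (geometric r r)) => [l|l|l|].
  - exact: normr_ge0.
  - by rewrite /= mulr_ge0 ?exprn_ge0.
  - rewrite /= -exprS; exact: le_trans (entry_le_norm_infty _ _ _) (powA l).
  - by apply: is_cvg_geometric_series; rewrite ger0_norm.
pose S := \matrix_(i, j) limn (series (fun l => (A ^+ l.+1) i j)).
have uS : u k @[k --> \oo] --> S.
  apply: cvg_mx => i j; rewrite mxE.
  under eq_fun do rewrite /u summxE.
  exact: entry_cvg.
exists S.
  (* The partial sum up to [k] has [k.-1] terms; shifting [k] by one aligns it
     with [u]. *)
  by rewrite -cvg_shiftS; under eq_fun do rewrite uE.
apply: (norm_infty_lim_le _ _ _ uS) => k.
apply: le_trans (matrix_norm_sum _ _ _ _ nN) _.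
apply: le_trans (geometric_sumS_le r k _); last by rewrite r0.
by apply: ler_sum => l _.
Qed.

(** * The gradient of the objective and the ratio q *)

(** Clearing denominators, both [r < d / (d + D)] and the second conclusion say
    [r * d + r * D < d]. *)
Lemma ratio_lt_of_lt_share {R : realType} (r d D : R) :
  0 <= d -> 0 < D -> r < d / (d + D) -> r < 1 /\ r / (1 - r) < d / D.
Proof.
move=> d0 D0 rdD.
have dD0 : 0 < d + D by rewrite ltr_wpDl.
have r1 : r < 1.
  by apply: lt_le_trans rdD _; rewrite ler_pdivrMr// mul1r lerDl ltW.
split=> //; move: rdD; rewrite ltr_pdivlMr// mulrDr => rdD.
rewrite ltr_pdivrMr ?subr_gt0// mulrAC ltr_pdivlMr//.
by rewrite mulrBr mulr1 ltrBrDr [d * r]mulrC addrC.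
Qed.

(** The difference quotient of [g] along the [i]-th basis vector is constantly
    [c], since [y |-> c * \sum_i y 0 i] is linear. *)
Lemma jacobian_scaled_sum {R : realType} {n m : nat}
    (g : 'rV[R]_n.+1 -> 'rV[R]_m.+1) (c : R) (x : 'rV[R]_n.+1) :
  differentiable g x -> (forall y j, g y 0 j = c * \sum_i y 0 i) ->
  forall i j, 'J g x i j = c.
Proof.
move=> dg gE i j.
have -> : 'J g x i j = row i ('J g x) 0 j by rewrite [RHS]mxE.
rewrite rowE -deriveEjacobian// /derive.
rewrite (@cvg_lim _ _ _ _ _ _ (const_mx c : 'rV[R]_m.+1)) ?mxE//.
apply: cvg_near_cst; near=> h.
have h0 : h != 0 by near: h; exact: nbhs_dnbhs_neq.
apply/rowP => k; rewrite !mxE /= !gE -mulrBr -sumrB.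
rewrite (bigD1 i) //= big1 => [|l li].
  by rewrite !mxE !eqxx mulr1 addr0 addrK mulrCA mulVf// mulr1.
by rewrite !mxE (negPf li) mulr0 add0r subrr.
Unshelve. all: by end_near. Qed.

Lemma qratio_const {R : realType} {n m : nat}
    (f0 : 'rV[R]_n.+1 -> 'rV[R]_m.+1) (x : 'rV[R]_n.+1) (c : R) :
  0 < c -> (forall i j, 'J f0 x i j = c) -> 1 <= qratio f0 x.
Proof.
move=> c0 f0c; apply: le_min_ord => j.
rewrite ler_pdivlMr; last by apply: max_ord_gt0 => i; rewrite f0c.
rewrite mul1r; apply: (@le_trans _ _ c).
  by apply: max_ord_le => i; rewrite f0c.
by apply: le_min_ord => i; rewrite f0c.
Qed.

(** The minimum and maximum of the gradient over the coordinates at the single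
    point [x] lie between the extrema over all coordinates and all of [D].  The
    infimum of positive entries may vanish when it is not attained, hence only
    [0 <= delta_bar]; the supremum is at least the positive entries at [x]. *)
Lemma qratio_ge_extrema {R : realType} {n : nat}
    (f0 : 'rV[R]_n.+1 -> 'rV[R]_1) (D : set 'rV[R]_n.+1) (x : 'rV[R]_n.+1) :
  (forall y, D y -> mx_lt 0 ('J f0 y)) ->
  (forall i, has_lbound (grad_range f0 D i) /\
             has_ubound (grad_range f0 D i)) ->
  D x ->
  [/\ 0 <= delta_bar f0 D, 0 < Delta_bar f0 D &
      delta_bar f0 D / Delta_bar f0 D <= qratio f0 x].
Proof.
move=> f0_gt0 f0_bnd Dx.
have gx i : grad_range f0 D i ('J f0 x i ord0) by exists x.
have f0x_gt0 i : 0 < 'J f0 x i ord0 by have := f0_gt0 x Dx i ord0; rewrite mxE.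
have delta_ge0 : 0 <= delta_bar f0 D.
  apply: le_min_ord => i; apply: lb_le_inf; first by exists ('J f0 x i ord0).
  by move=> _ [y Dy <-]; have := f0_gt0 y Dy i ord0; rewrite mxE => /ltW.
have delta_le i : delta_bar f0 D <= 'J f0 x i ord0.
  apply: le_trans (min_ord_lower _ i) _.
  by apply: ge_inf (gx i); exact: (f0_bnd i).1.
have Delta_ge i : 'J f0 x i ord0 <= Delta_bar f0 D.
  apply: le_trans (max_ord_upper _ i).
  by apply: ub_le_sup (gx i); exact: (f0_bnd i).2.
have Delta_gt0 : 0 < Delta_bar f0 D := lt_le_trans (f0x_gt0 ord0) (Delta_ge _).
split=> //; apply: le_min_ord => j; rewrite ord1.
have max_gt0 : 0 < max_ord ('J f0 x ^~ ord0) by exact: max_ord_gt0.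
apply: ler_pM => //; first by rewrite invr_ge0 ltW.
  exact: le_min_ord.
by rewrite lef_pV2 ?posrE//; exact: max_ord_le.
Qed.

(** * From each old case to the general condition *)

Lemma general_qualifying_of_pos {R : realType} {n m : nat}
    (f0 : 'rV[R]_n.+1 -> 'rV[R]_m.+1) (f : 'rV[R]_n.+1 -> 'rV[R]_n.+1)
    (N : 'M[R]_n.+1 -> R) (x : 'rV[R]_n.+1) :
  mx_lt 0 ('J f0 x) -> N ('J f x) < 1 ->
  (exists k, power_condition f0 f x k) -> general_qualifying f0 f N x.
Proof.
move=> f0_gt0 Nf kP; split=> //; split=> [i j|i]; first exact/ltW/f0_gt0.
apply/eqP => /rowP/(_ ord0); rewrite [LHS]mxE => f0_eq0.
by have := f0_gt0 i ord0; rewrite f0_eq0 !mxE ltxx.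
Qed.

(** [k = 1] makes (c) the nonnegativity of the Jacobian and (d) void. *)
Lemma case_i_qualifying {R : realType} {n m : nat}
    (f0 : 'rV[R]_n.+1 -> 'rV[R]_m.+1) (f : 'rV[R]_n.+1 -> 'rV[R]_n.+1)
    (D : set 'rV[R]_n.+1) :
  (forall x, D x -> mx_lt 0 ('J f0 x)) -> case_i f D ->
  exists2 N : 'M[R]_n.+1 -> R, matrix_norm N &
    forall x, D x -> general_qualifying f0 f N x.
Proof.
move=> f0_gt0 [N nN fP]; exists N => // x Dx; have [f_ge0 f_lt1] := fP x Dx.
apply: general_qualifying_of_pos => //; first exact: f0_gt0.
by exists (Some 1%N); split=> //; rewrite expr1.
Qed.

Lemma mx_sqr_ge0 {R : realType} {n : nat} (A : 'M[R]_n.+1) :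
  mx_le A 0 -> mx_le 0 (A ^+ 2).
Proof.
move=> A_le0 i j; rewrite expr2 !mxE; apply: sumr_ge0 => k _.
by apply: mulr_le0; [have := A_le0 i k | have := A_le0 k j]; rewrite mxE.
Qed.

(** [k = 2]: the sum in (d) reduces to the Jacobian itself, and [q(x) >= 1]. *)
Lemma case_ii_qualifying {R : realType} {n m : nat}
    (f0 : 'rV[R]_n.+1 -> 'rV[R]_m.+1) (f : 'rV[R]_n.+1 -> 'rV[R]_n.+1)
    (D : set 'rV[R]_n.+1) (df0 : forall x, differentiable f0 x) :
  (forall x, D x -> mx_lt 0 ('J f0 x)) -> case_ii f0 f D ->
  forall x, D x -> general_qualifying f0 f (@norm_infty R n) x.
Proof.
move=> f0_gt0 [_ [c c0 f0E] fP] x Dx; have [f_sgn f_lt1] := fP x Dx.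
apply: general_qualifying_of_pos => //; first exact: f0_gt0.
exists (Some 2%N); split=> //.
  by case: f_sgn => // f_le0; exact: mx_sqr_ge0.
move=> _; rewrite big_nat1 expr1; apply: lt_le_trans f_lt1 _.
apply: (qratio_const _ _ _ c0) => i j; exact: jacobian_scaled_sum.
Qed.

(** [k = oo]: the chain is [|S| <= r / (1 - r) < delta / Delta <= q(x)]. *)
Lemma case_iii_qualifying {R : realType} {n m : nat}
    (f0 : 'rV[R]_n.+1 -> 'rV[R]_m.+1) (f : 'rV[R]_n.+1 -> 'rV[R]_n.+1)
    (D : set 'rV[R]_n.+1) :
  (forall x, D x -> mx_lt 0 ('J f0 x)) -> case_iii f0 f D ->
  forall x, D x -> general_qualifying f0 f (@norm_infty R n) x.
Proof.
move=> + [[m0]]; move: f0; rewrite m0 => f0 f0_gt0 f0_bnd fP x Dx.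
have [delta_ge0 Delta_gt0 q_ge] := qratio_ge_extrema _ _ _ f0_gt0 f0_bnd Dx.
have [f_lt1 sum_lt] := ratio_lt_of_lt_share _ _ _ delta_ge0 Delta_gt0 (fP x Dx).
apply: general_qualifying_of_pos => //; first exact: f0_gt0.
have [S fS S_le] := neumann_series _ f_lt1.
exists None; exists S => //.
exact: le_lt_trans S_le (lt_le_trans sum_lt q_ge).
Qed.

Theorem proposition18 (R : realType) (n m : nat)
    (f0 : 'rV[R]_n.+1 -> 'rV[R]_m.+1) (f : 'rV[R]_n.+1 -> 'rV[R]_n.+1)
    (a b : 'rV[R]_n.+1)
    (df0 : forall x, differentiable f0 x) (df : forall x, differentiable f x)
    (fD : f @` box a b `<=` box a b)
    (old : old_qualifying f0 f (box a b)) :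
  exists2 N : 'M[R]_n.+1 -> R, matrix_norm N &
    forall x, box a b x -> general_qualifying f0 f N x.
Proof.
have [f0_gt0 [ci|cii|ciii]] := old.
- exact: case_i_qualifying.
- exists (@norm_infty R n); first exact: norm_infty_matrix_norm.
  exact: case_ii_qualifying.
- exists (@norm_infty R n); first exact: norm_infty_matrix_norm.
  exact: case_iii_qualifying.
Qed.
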